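(* Let $(X,\|\cdot\|_X)$ be a strictly convex real normed space, let $\|\cdot\|'_X$ be an equivalent norm defined on $X$, let $S_X=\{x\in X:\|x\|_X=1\}$ and $S'_X=\{x\in X:\|x\|'_X=1\}$, and let $\tau:S_X\to S'_X$ be an onto isometry, i.e. a surjective map with $\|\tau(x)-\tau(y)\|'_X=\|x-y\|_X$ for all $x,y\in S_X$. If the set of fixed points $\{x\in S_X:\tau(x)=x\}$ has nonempty interior relative to $S_X$, then $\tau$ is the identity (that is, $\tau(x)=x$ for every $x\in S_X$) and $\|\cdot\|'_X=\|\cdot\|_X$.
   Context: A normed space is strictly convex if its unit sphere contains no nondegenerate segment. No finite-dimensionality is assumed. *)

(* Defs.v *)
From HB Require Import structures.
From mathcomp Require Import all_boot all_order all_algebra.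
From mathcomp Require Import all_classical all_reals all_analysis.

Set Implicit Arguments.
Unset Strict Implicit.
Unset Printing Implicit Defensive.

Import Order.TTheory GRing.Theory Num.Theory.
Import numFieldNormedType.Exports.

Local Open Scope classical_set_scope.
Local Open Scope ring_scope.

(* Norms are plain functions [X -> R] here, so that two of them can live on the
   same vector space.  The axioms are those of the factory [Lmodule_isNormed];
   nonnegativity follows from them. *)
Record is_norm (R : realType) (X : lmodType R) (N : X -> R) : Prop := IsNorm {
  is_norm_triangle : forall x y, N (x + y) <= N x + N y ;
  is_normZ : forall (a : R) x, N (a *: x) = `|a| * N x ;
  is_norm_eq0 : forall x, N x = 0 -> x = 0
}.

Definition equivalent_norms (R : realType) (X : lmodType R) (N1 N2 : X -> R)
    : Prop :=
  exists c C : R, [/\ 0 < c, 0 < C & forall x, c * N1 x <= N2 x <= C * N1 x].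

Definition unit_sphere (R : realType) (X : lmodType R) (N : X -> R) : set X :=
  [set x | N x = 1].

Definition segment (R : realType) (X : lmodType R) (x y : X) : set X :=
  [set (1 - t) *: x + t *: y | t in `[0 : R, 1]%classic].

Definition strictly_convex (R : realType) (X : lmodType R) (N : X -> R)
    : Prop :=
  forall x y : X, segment x y `<=` unit_sphere N -> x = y.

(* Interior of [B] in the subspace topology of [A].  The library's [subspace A]
   has the whole of [T] as carrier, with points outside [A] isolated, so this is
   the usual relative interior only for [B `<=` A]. *)
Definition relative_interior (T : topologicalType) (A B : set T) : set T :=
  @interior (subspace A) B.

(* Main.v *)
(* Let [u1] be interior to the fixed set of [tau] in [S] and let [x0] be a fixed
   point other than [u1].  By strict convexity, lines close to the line [x0 u1]
   meet [S] near [u1], so the two norms agree near [u1 - x0].  If [x] in [S] is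
   close to [x0], then so is [y = tau x], and hence [|x - u| = |y - u|] for all
   [u] in [S] near [u1].  Taking two such points in an affine plane through [x]
   and [y], the quadrilateral inequality gives [x = y].  So the fixed set is open
   in [S]; it is also closed, and therefore contains all points joined to [u1]
   within [S] by the radial projection of a segment.  The remaining point [- u1]
   is fixed because it is the only point of [S] at distance 2 from [u1]. *)
Require Import Defs.
From mathcomp Require Import all_boot all_order all_algebra.
From mathcomp Require Import all_classical all_reals all_analysis.
From mathcomp Require Import ring lra.

Set Implicit Arguments.
Unset Strict Implicit.
Unset Printing Implicit Defensive.

Import Order.TTheory GRing.Theory Num.Theory.
Import numFieldNormedType.Exports.

Local Open Scope classical_set_scope.
Local Open Scope ring_scope.

(** * Equality cases in a strictly convex norm *)

(** Were some point of the segment of norm below 1, the given point would be a mixture of it, with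
    positive weight, and an endpoint, hence of norm below 1. *)
Lemma segment_norm1 (R : realType) (X : normedModType R) (x y : X) (t : R) :
  `|x| <= 1 -> `|y| <= 1 -> 0 < t < 1 -> `|(1 - t) *: x + t *: y| = 1 ->
  segment x y `<=` unit_sphere (fun z : X => `|z|).
Proof.
move=> x1 y1 /andP[t0 t1] zt z [s /=]; rewrite in_itv /= => /andP[s0 s1] <-.
have mix (k : R) (a b : X) : 0 <= k <= 1 ->
    `|(1 - k) *: a + k *: b| <= (1 - k) * `|a| + k * `|b|.
  move=> /andP[k0 k1]; apply: (le_trans (ler_normD _ _)).
  by rewrite !normrZ !ger0_norm// subr_ge0.
rewrite /unit_sphere /=; apply/eqP; rewrite eq_le; apply/andP; split.
  have := mix s x y; rewrite s0 s1 => /(_ isT) h; apply: (le_trans h); nra.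
set z' := _ + _.
have [st|ts] := leP s t.
  pose k := (t - s) / (1 - s).
  have s1' : 0 < 1 - s by lra.
  have k0 : 0 <= k by rewrite divr_ge0//; lra.
  have k1 : k < 1 by rewrite ltr_pdivrMr//; lra.
  have zE : (1 - t) *: x + t *: y = (1 - k) *: z' + k *: y.
    rewrite /z' scalerDr !scalerA -addrA -scalerDl; congr (_ *: _ + _ *: _);
    by rewrite /k; field; rewrite gt_eqF.
  have := mix k z' y; rewrite k0 ltW// => /(_ isT).
  rewrite -zE zt => h; nra.
pose k := t / s.
have s0' : 0 < s by lra.
have k0 : 0 < k by rewrite divr_gt0.
have k1 : k <= 1 by rewrite ler_pdivrMr//; lra.
have zE : (1 - t) *: x + t *: y = (1 - k) *: x + k *: z'.
  rewrite /z' scalerDr !scalerA addrA -scalerDl; congr (_ *: _ + _ *: _);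
  by rewrite /k; field; rewrite gt_eqF.
have := mix k x z'; rewrite k1 ltW// => /(_ isT).
rewrite -zE zt => h; nra.
Qed.

Lemma strictly_convex_lt1 (R : realType) (X : normedModType R) (x y : X)
    (t : R) : strictly_convex (fun z : X => `|z|) ->
  `|x| <= 1 -> `|y| <= 1 -> x != y -> 0 < t < 1 ->
  `|(1 - t) *: x + t *: y| < 1.
Proof.
move=> sc x1 y1 xy t01; rewrite lt_neqAle; apply/andP; split.
  by apply: contra xy => /eqP h; apply/eqP/sc/(segment_norm1 x1 y1 t01).
have /andP[t0 t1] := t01; apply: (le_trans (ler_normD _ _)).
rewrite !normrZ !ger0_norm//; [nra|lra|lra].
Qed.

(** For nonzero [a], dividing [a + b] by [|a| + |b|] gives a mixture of the normalised [a] and [b]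
    that has norm 1, so these two coincide. *)
Lemma strictly_convex_normD (R : realType) (X : normedModType R) (a b : X) :
  strictly_convex (fun z : X => `|z|) -> b != 0 -> `|a + b| = `|a| + `|b| ->
  exists2 k : R, 0 <= k & a = k *: b.
Proof.
move=> sc b0 abE; have [->|a0] := eqVneq a 0; first by exists 0; rewrite ?scale0r.
have na : 0 < `|a| by rewrite normr_gt0.
have nb : 0 < `|b| by rewrite normr_gt0.
exists (`|a| / `|b|); first by rewrite divr_ge0.
have unit (c : X) : 0 < `|c| -> `| `|c|^-1 *: c| <= 1.
  by move=> c0; rewrite normrZ normfV normr_id mulVf ?gt_eqF.
have ab : 0 < `|a| + `|b| by lra.
pose t := `|b| / (`|a| + `|b|).
have t01 : 0 < t < 1 by rewrite divr_gt0//= ltr_pdivrMr//; lra.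
have [E|/eqP ne] := pselect (`|a|^-1 *: a = `|b|^-1 *: b).
  by rewrite -scalerA -E scalerA divff ?gt_eqF// scale1r.
have := strictly_convex_lt1 sc (unit _ na) (unit _ nb) ne t01.
have -> : (1 - t) *: (`|a|^-1 *: a) + t *: (`|b|^-1 *: b)
    = (`|a| + `|b|)^-1 *: (a + b).
  rewrite scalerDr !scalerA; congr (_ *: _ + _ *: _); rewrite /t; field;
  by rewrite !gt_eqF.
by rewrite normrZ abE ger0_norm ?invr_ge0 ?ltW// mulVf ?ltxx// gt_eqF.
Qed.

(* The segments from [x] to [u2] and from [u1] to [y] are the diagonals of a
   quadrilateral meeting at [p]; their total length strictly exceeds that of
   the sides [x u1] and [y u2] unless the quadrilateral degenerates. *)
Lemma equidistant_eq (R : realType) (X : normedModType R) (x y u1 u2 p : X)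
    (k m : R) : strictly_convex (fun z : X => `|z|) ->
  0 < k < 1 -> 1 <= m ->
  p = k *: u1 + (1 - k) *: y -> u2 = x + m *: (p - x) ->
  `|x - u1| = `|y - u1| -> `|x - u2| = `|y - u2| -> x = y.
Proof.
move=> sc /andP[k0 k1] m1 pE u2E d1 d2.
have [yu|yu] := eqVneq y u1.
  by move: d1; rewrite yu subrr normr0 => /normr0_eq0/subr0_eq.
have pu1 : p - u1 = (1 - k) *: (y - u1).
  rewrite pE scalerBr addrAC [RHS]addrC; congr (_ + _).
  by rewrite -{2}(scale1r u1) -scalerBl -scaleNr; congr (_ *: _); ring.
have yp : y - p = k *: (y - u1).
  by rewrite -(subrKA u1 y (- p)) -(opprB p u1) pu1 -{1}(scale1r (y - u1)) -scalerBl;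
    congr (_ *: _); ring.
have u2p : u2 - p = (m - 1) *: (p - x).
  by rewrite u2E scalerBl scale1r addrAC addrC opprB addrC.
have n1 : `|p - u1| = (1 - k) * `|y - u1|.
  by rewrite pu1 normrZ ger0_norm//; lra.
have n2 : `|y - p| = k * `|y - u1| by rewrite yp normrZ gtr0_norm.
have n3 : `|u2 - p| = (m - 1) * `|x - p|.
  by rewrite u2p normrZ ger0_norm ?subr_ge0// distrC.
have n4 : `|x - u2| = m * `|x - p|.
  by rewrite u2E opprD addNKr normrN normrZ distrC ger0_norm//; lra.
(* The two upper bounds add up to [|x - u2| + |y - u1|], which by [d1] and [d2] is also the sum of
   the two bounded lengths; so both inequalities are equalities. *)
have t1 := ler_distD p x u1.
have t2 := ler_distD p y u2.
rewrite (distrC p u2) in t2.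
have E : `|(x - p) + (p - u1)| = `|x - p| + `|p - u1|.
  by rewrite subrKA; lra.
have pu0 : p - u1 != 0.
  by rewrite pu1 scaler_eq0 subr_eq0 gt_eqF//= subr_eq0.
have [q q0 qE] := strictly_convex_normD sc pu0 E.
(* [x - u1] is a nonnegative multiple of [y - u1] of the same length, so the factor is 1. *)
have xu : x - u1 = ((q + 1) * (1 - k)) *: (y - u1).
  by rewrite -(subrKA p x (- u1)) qE -{2}(scale1r (p - u1)) -scalerDl pu1 scalerA.
have : ((q + 1) * (1 - k) - 1) * `|y - u1| = 0.
  rewrite mulrBl mul1r -{2}d1 xu normrZ ger0_norm ?subrr//.
  by rewrite mulr_ge0; lra.
move=> /eqP; rewrite mulf_eq0 normr_eq0 subr_eq0 (subr_eq0 y) (negbTE yu) orbF.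
by move=> /eqP r1; move: xu; rewrite r1 scale1r => /addIr.
Qed.

(** * Lines crossing the sphere *)

(** On the line from [x0] through [u1] the norm is below 1 just before [u1] and above 1 just after
    it. Both strict inequalities survive a small perturbation, and the intermediate value theorem
    gives a crossing. *)
Lemma chord_nbhd (R : realType) (X : normedModType R) (x0 u1 : X) (e : R) :
  strictly_convex (fun z : X => `|z|) ->
  `|x0| = 1 -> `|u1| = 1 -> x0 != u1 -> 0 < e ->
  exists2 d : R, 0 < d & forall x w : X,
    `|x - x0| < d -> `|w - (u1 - x0)| < d ->
    exists l : R, [/\ 1 / 2 <= l, `|x + l *: w| = 1 & `|x + l *: w - u1| < e].
Proof.
move=> sc x01 u11 xu e0.
pose r : R := Num.min (1 / 2) (e / 4).
have r0 : 0 < r by rewrite lt_min; lra.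
have [r2 re] : r <= 1 / 2 /\ r <= e / 4.
  by split; rewrite ge_min lexx ?orbT.
pose v := u1 - x0.
have v2 : `|v| <= 2 by apply: (le_trans (ler_normB _ _)); rewrite x01 u11; lra.
have A1 : `|x0 + (1 - r) *: v| < 1.
  have -> : x0 + (1 - r) *: v = (1 - (1 - r)) *: x0 + (1 - r) *: u1.
    by rewrite [(1 - (1 - r)) *: _]scalerBl scale1r scalerBr addrA addrAC.
  apply: strictly_convex_lt1 => //; rewrite ?x01 ?u11//; lra.
have B1 : 1 < `|x0 + (1 + r) *: v|.
  rewrite ltNge; apply/negP => q1.
  set q := x0 + _ in q1.
  have r1 : 1 + r != 0 by rewrite gt_eqF//; lra.
  have xq : x0 != q.
    rewrite -subr_eq0 /q opprD addNKr oppr_eq0 scaler_eq0 (negbTE r1)/=.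
    by rewrite subr_eq0 eq_sym.
  have k01 : 0 < (1 + r)^-1 < 1.
    by rewrite invr_gt0 invf_lt1; lra.
  have := strictly_convex_lt1 sc _ q1 xq k01; rewrite x01 => /(_ (lexx _)).
  have -> : (1 - (1 + r)^-1) *: x0 + (1 + r)^-1 *: q = u1.
    rewrite /q scalerDr scalerA mulVf// scale1r scalerBl scale1r.
    by rewrite addrA subrK addrC subrK.
  by rewrite u11 ltxx.
set A := `|_| in A1; set B := `|_| in B1.
(* For [l] up to 3/2 the perturbation moves a point by at most [5 / 2 * d]: half of each gap at [A]
   and [B], and little enough to leave [e / 2] for the drift along [v]. *)
pose d := Num.min (e / 8) (Num.min ((1 - A) / 5) ((B - 1) / 5)).
have [d0 [de [dA dB]]] : 0 < d /\ d <= e / 8 /\ d <= (1 - A) / 5 /\ d <= (B - 1) / 5.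
  by rewrite !lt_min !ge_min !lexx !orbT; do !split; lra.
exists d => // x w hx hw.
have near (l : R) : 0 <= l <= 3 / 2 ->
    `|(x + l *: w) - (x0 + l *: v)| <= 5 / 2 * d.
  move=> /andP[l0 l2]; rewrite opprD addrACA -scalerBr.
  apply: (le_trans (ler_normD _ _)); rewrite normrZ ger0_norm//; nra.
have fA : `|x + (1 - r) *: w| <= 1.
  have := near (1 - r); rewrite (_ : (_ <= _ <= _) = true); last lra.
  have := ler_normD (x + (1 - r) *: w - (x0 + (1 - r) *: v)) (x0 + (1 - r) *: v).
  rewrite subrK -/A => h1 /(_ isT) h2; lra.
have fB : 1 <= `|x + (1 + r) *: w|.
  have := near (1 + r); rewrite (_ : (_ <= _ <= _) = true); last lra.
  have := ler_normD (x0 + (1 + r) *: v - (x + (1 + r) *: w)) (x + (1 + r) *: w).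
  rewrite subrK -/B distrC => h1 /(_ isT) h2; lra.
have ab : 1 - r <= 1 + r by lra.
have cont : {within `[1 - r, 1 + r], continuous (fun l : R => `|x + l *: w|)}.
  apply: continuous_subspaceT => l.
  apply: cvg_norm; apply: cvgD; first exact: cvg_cst.
  by apply: cvgZr_tmp; exact: cvg_id.
have [|l] := IVT (v := 1) ab cont.
  by rewrite ge_min fA le_max fB orbT.
rewrite in_itv /= => /andP[l1 l2] fl; exists l; split => //; first lra.
have l3 : 0 <= l <= 3 / 2 by lra.
have -> : x + l *: w - u1 = (x + l *: w - (x0 + l *: v)) + (l - 1) *: v.
  by rewrite scalerBl scale1r /v opprB opprD !addrA subrK subrK.
apply: (le_lt_trans (ler_normD _ _)); rewrite normrZ.
have lr : `|l - 1| <= r by rewrite ler_norml; lra.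
have := near l l3.
have := normr_ge0 v; have := normr_ge0 (l - 1) => *; nra.
Qed.

(** * Connectedness of the sphere *)

(** The segment from [x0] to [x] misses 0 and projects radially to a path in the sphere; the
    parameters where [P] holds are relatively clopen in the unit interval. *)
Lemma unit_sphere_clopen (R : realType) (X : normedModType R) (P : X -> Prop)
    (x0 x : X) :
  (forall z, `|z| = 1 -> P z -> exists2 d : R, 0 < d &
     forall z', `|z'| = 1 -> `|z' - z| < d -> P z') ->
  (forall z, `|z| = 1 -> ~ P z -> exists2 d : R, 0 < d &
     forall z', `|z'| = 1 -> `|z' - z| < d -> ~ P z') ->
  `|x0| = 1 -> `|x| = 1 -> x != - x0 -> P x0 -> P x.
Proof.
move=> Po Pc x01 x1 xx0 Px0.
pose h (t : R) := (1 - t) *: x0 + t *: x.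
pose g t := `|h t|^-1 *: h t.
have h0 t : t \in `[0, 1] -> h t != 0.
  rewrite in_itv /= => /andP[t0 t1]; apply: contra xx0; rewrite addr_eq0 => /eqP E.
  have := congr1 Num.norm E; rewrite normrN !normrZ x01 x1 !mulr1.
  rewrite !ger0_norm ?subr_ge0// => tE.
  have t0' : t != 0 by apply/eqP => t00; lra.
  by move: E; rewrite tE -scalerN => /(scalerI t0') ->; rewrite opprK.
have g1 t : t \in `[0, 1] -> `|g t| = 1.
  move=> /h0 ht; rewrite /g normrZ normfV normr_id mulVf// normr_eq0 //.
have hc : continuous h.
  move=> t; apply: cvgD; apply: cvgZr_tmp; last exact: cvg_id.
  by apply: cvgB; [exact: cvg_cst|exact: cvg_id].
have gc t : t \in `[0, 1] -> {for t, continuous g}.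
  move=> /h0 ht; apply: cvgZ; last exact: hc.
  by apply: cvgV; [rewrite normr_eq0|apply: cvg_norm; exact: hc].
have gnear (Q : X -> Prop) t : t \in `[0, 1] ->
    (exists2 d : R, 0 < d & forall z', `|z'| = 1 -> `|z' - g t| < d -> Q z') ->
    nbhs t [set s | s \in `[0, 1] -> Q (g s)].
  move=> t01 [d d0 dQ].
  have /cvgrPdist_lt/(_ d d0) := gc t t01.
  apply: filterS => s /= sd s01; apply: dQ; first exact: g1.
  by rewrite distrC.
(* Parameters outside the interval belong vacuously, so neighbourhoods in the real line also serve
   at the endpoints. *)
pose U := [set s | s \in `[0, 1] -> P (g s)].
pose V := [set s | s \in `[0, 1] -> ~ P (g s)].
have UP t : t \in `[0, 1] -> P (g t) -> nbhs t U.
  by move=> t01 Pt; apply: gnear => //; apply: Po => //; exact: g1.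
have VP t : t \in `[0, 1] -> ~ P (g t) -> nbhs t V.
  by move=> t01 Pt; apply: (gnear (fun z => ~ P z)) => //; apply: Pc => //; exact: g1.
have [i0 i1] : (0 : R) \in `[0, 1] /\ (1 : R) \in `[0, 1].
  by rewrite !in_itv/= !lexx ler01.
have g0E : g 0 = x0.
  by rewrite /g /h subr0 scale0r addr0 scale1r x01 invr1 scale1r.
have g1E : g 1 = x.
  by rewrite /g /h subrr scale0r add0r scale1r x1 invr1 scale1r.
have : [set t | t \in `[0, 1] /\ P (g t)] = `[(0 : R), 1]%classic.
  apply: segment_connected.
  - by exists 0; rewrite /= g0E.
  - exists (U°); first exact: open_interior.
    apply/seteqP; split=> [t /= [t01 Pt]|t /= [t01]].
      by split => //; exact: UP.
    by move=> /interior_subset /(_ t01).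
  - exists (~` V°); first by rewrite closedC; exact: open_interior.
    apply/seteqP; split=> [t /= [t01 Pt]|t /= [t01 Vt]].
      by split => // /interior_subset /(_ t01).
    split => //; apply: contrapT => /(VP _ t01); exact: Vt.
by move=> /seteqP[_ /(_ 1 i1)] /= [_]; rewrite g1E.
Qed.

(** * Propagation of fixed points *)

Lemma fixed_nbhd (R : realType) (X : normedModType R) (N' : X -> R)
    (tau : X -> X) (x0 u1 : X) (e : R) :
  strictly_convex (fun z : X => `|z|) ->
  is_norm N' -> equivalent_norms (fun z : X => `|z|) N' ->
  (forall x y, `|x| = 1 -> `|y| = 1 -> N' (tau x - tau y) = `|x - y|) ->
  `|x0| = 1 -> tau x0 = x0 -> `|u1| = 1 -> 0 < e ->
  (forall u, `|u| = 1 -> `|u - u1| < e -> tau u = u) ->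
  exists2 d : R, 0 < d &
    forall x, `|x| = 1 -> `|x - x0| < d -> tau x = x.
Proof.
move=> sc [_ N'Z _] [c [C [c0 _ cC]]] iso x01 tx0 u11 e0 fixU.
have [xu|xu] := eqVneq x0 u1; first by exists e; rewrite ?xu.
have [d1 d10 ch1] := chord_nbhd sc x01 u11 xu e0.
(* Up to scaling, [w] is a chord from [x0] to a point of the sphere near [u1]; both ends are fixed,
   so the isometry equates its two norms. *)
have N'E w : `|w - (u1 - x0)| < d1 -> N' w = `|w|.
  move=> hw; have [|l [l2 l1 le]] := ch1 x0 w _ hw; first by rewrite subrr normr0.
  have := iso _ _ l1 x01; rewrite tx0 fixU// [x0 + _]addrC addrK N'Z normrZ.
  by move/mulfI; apply; rewrite gt_eqF// normr_gt0 gt_eqF//; lra.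
have e'0 : 0 < Num.min e (d1 / 2) by rewrite lt_min e0; lra.
have [d2 d20 ch2] := chord_nbhd sc x01 u11 xu e'0.
(* [d1 / 2] keeps [u - y] in the range of [N'E], and [d2 / 4] keeps [|y - x|] below [d2 / 2]. The
   factor [c] below turns the [N'] bound on [y - x0] into a bound in the original norm. *)
pose m := Num.min (d1 / 2) (d2 / 4).
have [m0 [m1 m2]] : 0 < m /\ m <= d1 / 2 /\ m <= d2 / 4.
  by rewrite lt_min !ge_min !lexx !orbT; do !split; lra.
exists (Num.min m (c * m)); first by rewrite lt_min m0 mulr_gt0.
move=> x x1; rewrite lt_min => /andP[xm xcm].
set y := tau x.
have ym : `|y - x0| < m.
  have /andP[+ _] := cC (y - x0); rewrite -{2}tx0 iso// => h.
  by rewrite -(ltr_pM2l c0); exact: le_lt_trans h xcm.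
have equi u : `|u| = 1 -> `|u - u1| < e -> `|u - u1| < d1 / 2 ->
    `|x - u| = `|y - u|.
  move=> n1 ue ud; rewrite [LHS]distrC -iso// (fixU u n1 ue) N'E; first exact: distrC.
  have -> : u - y - (u1 - x0) = (u - u1) - (y - x0).
    by rewrite !opprB addrACA (addrC (- y)) addrACA.
  by apply: (le_lt_trans (ler_normB _ _)); lra.
have [//|xy] := eqVneq y x.
have dn : 0 < `|y - x| by rewrite normr_gt0 subr_eq0.
have dd : `|y - x| < d2 / 2.
  by have := ler_distD x0 y x; rewrite (distrC x0); lra.
(* The length of [s *: (y - x)] is fixed while [y - x] may be tiny; this makes
   [s] at least [1], so that [u2] lies beyond the segment from [u1] to [y]. *)
pose s := d2 / 2 / `|y - x|.
have s1 : 1 <= s by rewrite ler_pdivlMr// mul1r ltW.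
(* This is [1 + s] times the vector from [x] to the point dividing the segment from [u1] to [y] with
   weights [k] and [1 - k], where [k] is the inverse of [1 + s]. *)
pose w := u1 - x + s *: (y - x).
have hw : `|w - (u1 - x0)| < d2.
  have -> : w - (u1 - x0) = - (x - x0) + s *: (y - x).
    by rewrite /w addrAC !opprB (addrC (u1 - x)) subrKA.
  apply: (le_lt_trans (ler_normD _ _)); rewrite normrN normrZ ger0_norm; last lra.
  by rewrite /s divfK ?gt_eqF//; lra.
have xd2 : `|x - x0| < d2 by lra.
have [l [l2 l1]] := ch2 x w xd2 hw; rewrite lt_min => /andP[le ld].
symmetry.
pose k := (1 + s)^-1.
have s0 : 1 + s != 0 by rewrite gt_eqF//; lra.
apply: (equidistant_eq (k := k) (m := l * (1 + s)) (u1 := u1) sc _ _ erefl)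
  (equi _ l1 le ld).
- by rewrite /k invr_gt0 invf_lt1; lra.
- nra.
- rewrite -scalerA; congr (_ + _ *: _).
  rewrite scalerBr scalerDr !scalerA mulfV// scale1r /w.
  have -> : (1 + s) * (1 - k) = s by rewrite /k; field.
  by rewrite scalerDl scale1r opprD scalerBr !addrA; congr (_ - _); rewrite addrAC.
- by apply: equi => //; rewrite subrr normr0//; lra.
Qed.

Theorem theorem3p11 (R : realType) (X : normedModType R) (N' : X -> R)
    (tau : X -> X) :
  let S := unit_sphere (fun x : X => `|x|) in
  let S' := unit_sphere N' in
  strictly_convex (fun x : X => `|x|) ->
  is_norm N' ->
  equivalent_norms (fun x : X => `|x|) N' ->
  set_fun S S' tau ->
  set_surj S S' tau ->
  (forall x y, S x -> S y -> N' (tau x - tau y) = `|x - y|) ->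
  relative_interior S [set x | S x /\ tau x = x] !=set0 ->
  (forall x, S x -> tau x = x) /\ (forall x, N' x = `|x|).
Proof.
move=> S S' sc nN' eqN' tauS tauO iso [u0 intu0].
have [_ N'Z _] := nN'; have [c [C [c0 _ cC]]] := eqN'.
have [u01 tu0] := interior_subset intu0.
have [e e0 eU] : exists2 e : R, 0 < e &
    forall u, `|u| = 1 -> `|u - u0| < e -> tau u = u.
  move: intu0 => /(nbhs_subspace_ex _ u01)[V /nbhs_ballP[e /= e0 eV] VS].
  exists e => // u u1 uu0.
  suff : ([set x | S x /\ tau x = x] `&` S) u by case=> -[].
  by rewrite VS; split => //; apply: eV; rewrite -ball_normE /= distrC.
have fixed x : `|x| = 1 -> tau x = x.
  move=> x1; have [->|xu] := eqVneq x (- u0).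
    (* [- u0] is the only point of [S] at distance [2] from [u0]. *)
    have N'u0 : N' u0 = 1 by rewrite -tu0; exact: tauS.
    have N'N z : N' (- z) = N' z by rewrite -scaleN1r N'Z normrN1 mul1r.
    (* Surjectivity enters here: the isometry puts a preimage of [- u0] at distance 2 from [u0]. *)
    have [z z1 tz] : (tau @` S) (- u0) by apply: tauO; rewrite /S' /unit_sphere /= N'N.
    have := iso u0 z u01 z1.
    rewrite tz tu0 opprK -mulr2n -scaler_nat N'Z N'u0 mulr1 normr_nat => E.
    suff zE : - u0 = z by rewrite {1}zE.
    apply: contrapT => /eqP uz.
    have h01 : 0 < (1 / 2 : R) < 1 by lra.
    have := strictly_convex_lt1 sc _ _ uz h01.
    rewrite normrN u01 z1 lexx => /(_ isT isT).
    have -> : (1 - 1 / 2) *: - u0 + (1 / 2) *: z = - (1 / 2) *: (u0 - z).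
      by rewrite scalerBr scalerN !scaleNr opprK; congr (- (_ *: _) + _); field.
    by rewrite normrZ -E normrN ger0_norm; lra.
  apply: (unit_sphere_clopen (P := fun z => tau z = z) _ _ u01 x1 xu tu0).
    by move=> z z1 tz; exact: (fixed_nbhd sc nN' eqN' iso z1 tz u01 e0 eU).
  move=> z z1 tz.
  have n0 : 0 < `|tau z - z| by rewrite normr_gt0 subr_eq0; apply/eqP.
  (* If [z'] is this close to [z], then [z'] and [tau z'] lie within half of [|tau z - z|] of [z]
     and [tau z] respectively, so they differ. *)
  pose d := Num.min (`|tau z - z| / 2) (c * (`|tau z - z| / 2)).
  exists d; first by rewrite lt_min divr_gt0//= mulr_gt0// divr_gt0.
  move=> z' z'1; rewrite lt_min => /andP[zd zcd] tz'.
  have /andP[+ _] := cC (tau z' - tau z); rewrite iso// => h.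
  have : `|tau z' - tau z| < `|tau z - z| / 2.
    by rewrite -(ltr_pM2l c0); exact: le_lt_trans h zcd.
  rewrite tz' => h'; have := ler_distD z' (tau z) z; rewrite (distrC (tau z) z'); lra.
(* Every unit vector is its own image, hence lies in [S']; homogeneity does the rest. *)
split=> // x; have [->|x0] := eqVneq x 0.
  by rewrite -(scale0r 0) N'Z normr0 mul0r scale0r normr0.
have nx : `|x| != 0 by rewrite normr_eq0.
have n1 : `| `|x|^-1 *: x| = 1 by rewrite normrZ normfV normr_id mulVf.
have := tauS _ n1; rewrite fixed// /S' /unit_sphere /= N'Z normfV normr_id.
by move=> E; rewrite -[RHS]mulr1 -E mulVKf.
Qed.
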